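(* Let $(\mathbb{R}^n,g)$, $n\ge 3$, be the Euclidean space with coordinates $x_1,\dots,x_n$ and metric $g_{ij}=\delta_{ij}$. Then there exists a metric $\bar g=\frac{1}{\varphi^2}g$ such that $\bar R=R=f\,(g\odot g)$, where $\bar R$ is the Riemannian curvature tensor of $\bar g$ and $f$ is a nonvanishing smooth function, if and only if $$f(x)=\frac{-\lambda}{2\left(\sum_{i=1}^n(ax_i^2+b_ix_i)+c\right)^4},$$ where $a,b_i,c$ are constants, $\lambda=\sum_{i=1}^n b_i^2-4ac$, and $$\varphi(x)=\sum_{i=1}^n(ax_i^2+b_ix_i)+c.$$ Any such metric $\bar g$ is unique up to homothety. Moreover: (1) if $\lambda<0$, then $\bar g$ is globally defined on $\mathbb{R}^n$; (2) if $\lambda\ge0$, then the set of singularities of $\bar g$ is (a) the empty set if $\lambda=0$ and $a=0$; (b) a point if $\lambda=0$ and $a\ne0$; (c) a hyperplane if $\lambda>0$ and $a=0$; (d) an $(n-1)$-dimensional sphere if $\lambda>0$ and $a\ne0$.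
   Context: For symmetric $(0,2)$-tensors $h,k$ the Kulkarni–Nomizu product is $(h\odot k)(X,Y,Z,W)=h(X,Z)k(Y,W)+h(Y,W)k(X,Z)-h(X,W)k(Y,Z)-h(Y,Z)k(X,W)$. The Riemannian curvature $(0,4)$-tensor of a metric $\tilde g$ is taken with the convention under which $R_{\tilde g}=W_{\tilde g}+A_{\tilde g}\odot\tilde g$, where $W_{\tilde g}$ is the Weyl tensor and $A_{\tilde g}=\frac{1}{n-2}\left(\mathrm{Ric}_{\tilde g}-\frac{K_{\tilde g}}{2(n-1)}\tilde g\right)$ is the Schouten tensor, $\mathrm{Ric}_{\tilde g}$ and $K_{\tilde g}$ being the Ricci tensor and scalar curvature. The singularities of $\bar g=g/\varphi^2$ are the points where $\varphi$ vanishes. *)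

(* Defs.v *)
From HB Require Import structures.
From mathcomp Require Export all_boot all_order all_algebra.
From mathcomp Require Export boolp classical_sets functions reals topology
  normedtype derive.

Set Implicit Arguments.
Unset Strict Implicit.
Unset Printing Implicit Defensive.

Export Order.TTheory GRing.Theory Num.Theory.
Export numFieldNormedType.Exports.

#[global] Open Scope classical_set_scope.
#[global] Open Scope ring_scope.

Section Calculus.
Variables (R : realType) (n : nat).

Definition partial (i : 'I_n) (u : 'rV[R]_n -> R) : 'rV[R]_n -> R :=
  fun x => 'D_(delta_mx 0 i) u x.

Definition iter_partial (s : seq 'I_n) (u : 'rV[R]_n -> R) : 'rV[R]_n -> R :=
  foldr partial u s.

(* C^oo on U; meant for open U, where differentiability of all the iterated
   partial derivatives makes each of them exist and be continuous. *)
Definition smooth_on (U : set 'rV[R]_n) (u : 'rV[R]_n -> R) : Prop :=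
  forall (s : seq 'I_n) (x : 'rV[R]_n), U x -> differentiable (iter_partial s u) x.

End Calculus.

Section Curvature.
Variables (R : realType) (n : nat).

(* A (0,2)-tensor at a point is the matrix of its components in the coordinate
   frame; a (0,4)-tensor at a point is a function of four tangent vectors. *)
Definition tensor2 (h : 'M[R]_n) (X Y : 'rV[R]_n) : R := (X *m h *m Y^T) 0 0.

Definition kulkarni_nomizu (h k : 'M[R]_n) (X Y Z W : 'rV[R]_n) : R :=
  tensor2 h X Z * tensor2 k Y W + tensor2 h Y W * tensor2 k X Z
  - tensor2 h X W * tensor2 k Y Z - tensor2 h Y Z * tensor2 k X W.

Variable G : 'rV[R]_n -> 'M[R]_n.

(* Gamma^k_ij of the Levi-Civita connection of the metric G *)
Definition christoffel (k i j : 'I_n) (x : 'rV[R]_n) : R :=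
  2^-1 * \sum_l invmx (G x) k l *
    (partial i (fun y => G y j l) x + partial j (fun y => G y i l) x
     - partial l (fun y => G y i j) x).

(* The coefficient on d_m of R(d_i, d_j) d_l, where
   R(X, Y) = [nabla_X, nabla_Y] - nabla_[X, Y]. *)
Definition curvature_endo (i j l m : 'I_n) (x : 'rV[R]_n) : R :=
  partial i (christoffel m j l) x - partial j (christoffel m i l) x
  + \sum_p (christoffel m i p x * christoffel p j l x
            - christoffel m j p x * christoffel p i l x).

(* (X, Y, Z, W) |-> G(R(X, Y) W, Z).  This is the sign for which the unit round
   sphere, whose Schouten tensor is A = 1/2 G, has curvature
   A (.) G = 1/2 (G (.) G), (.) being the Kulkarni-Nomizu product. *)
Definition riemann (x X Y Z W : 'rV[R]_n) : R :=
  \sum_i \sum_j \sum_k \sum_l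
    (\sum_m G x k m * curvature_endo i j l m x)
    * X 0 i * Y 0 j * Z 0 k * W 0 l.

End Curvature.

Section ConformalMetric.
Variables (R : realType) (n : nat).

Definition euclidean_metric : 'M[R]_n := 1%:M.

(* phi^-2 g; meaningful only off the singularities of phi. *)
Definition conformal_metric (phi : 'rV[R]_n -> R) (x : 'rV[R]_n) : 'M[R]_n :=
  (phi x ^+ 2)^-1 *: euclidean_metric.

Definition singularities (phi : 'rV[R]_n -> R) : set 'rV[R]_n :=
  [set x | phi x = 0].

Definition has_prescribed_curvature (f phi : 'rV[R]_n -> R) : Prop :=
  forall x, ~ singularities phi x -> forall X Y Z W,
    riemann (conformal_metric phi) x X Y Z W =
    f x * kulkarni_nomizu euclidean_metric euclidean_metric X Y Z W.

(* phi is smooth on R^n and phi^-2 g is a metric on the open, nonempty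
   complement of the singularities of phi.  Only the values of f on this
   complement matter. *)
Record is_solution (f phi : 'rV[R]_n -> R) : Prop := IsSolution {
  sol_smooth : smooth_on setT phi ;
  sol_nonempty : exists x, ~ singularities phi x ;
  sol_f_smooth : smooth_on (~` singularities phi) f ;
  sol_f_nonvanishing : forall x, ~ singularities phi x -> f x != 0 ;
  sol_curvature : has_prescribed_curvature f phi }.

Definition homothetic (phi psi : 'rV[R]_n -> R) : Prop :=
  singularities phi = singularities psi /\
  exists2 k : R, 0 < k & forall x, ~ singularities phi x ->
    conformal_metric phi x = k *: conformal_metric psi x.

Definition quadratic (a : R) (b : 'rV[R]_n) (c : R) (x : 'rV[R]_n) : R :=
  \sum_i (a * x 0 i ^+ 2 + b 0 i * x 0 i) + c.

Definition lambda (a : R) (b : 'rV[R]_n) (c : R) : R :=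
  \sum_i b 0 i ^+ 2 - 4 * a * c.

Definition curvature_factor (a : R) (b : 'rV[R]_n) (c : R) (x : 'rV[R]_n) : R :=
  - lambda a b c / (2 * quadratic a b c x ^+ 4).

Definition is_hyperplane (S : set 'rV[R]_n) : Prop :=
  exists (v : 'rV[R]_n) (d : R),
    v != 0 /\ S = [set x | \sum_i v 0 i * x 0 i = d].

(* Written out because the norm that the library puts on 'rV[R]_n is the sup
   norm. *)
Definition is_sphere (S : set 'rV[R]_n) : Prop :=
  exists (p : 'rV[R]_n) (r : R),
    0 < r /\ S = [set x | \sum_i (x 0 i - p 0 i) ^+ 2 = r ^+ 2].

End ConformalMetric.

(* Main.v *)
Require Import Defs.
From mathcomp Require Import landau ring lra.

Set Implicit Arguments.
Unset Strict Implicit.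
Unset Printing Implicit Defensive.

(** Write [p = d phi / phi] and [A = Hess phi / phi - |p|^2 / 2 g].  The curvature
    of [phi^-2 g] is [phi^-2 (A (.) g)], where [(.)] is the Kulkarni-Nomizu product,
    so for [n >= 3] the prescribed curvature equation says exactly that
    [A = f phi^2 g].  In particular [Hess phi] is pointwise a multiple of [g] where
    [phi <> 0], and there its third derivatives vanish by the symmetry of mixed
    partials.  They also vanish on the interior of the zero set, hence everywhere by
    continuity, so [phi] is a quadratic polynomial with Hessian [2 a g].  The identity
    [|d phi|^2 = lambda + 4 a phi] then gives both [f] and the shape of the zero set.
    If two quadratics [q1], [q2] yield the same [f], then
    [lambda1 q2^4 = lambda2 q1^4] away from their zeros, which forces the same zeros
    and the homothety. *)

(** Differentiability depends only on the germ: [f] is [g] plus [f - g], and the latter vanishes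
    near [x]. *)
Lemma near_eq_differentiable (K : numFieldType) (V W : normedModType K)
    (f g : V -> W) (x : V) :
  {near x, f =1 g} -> differentiable g x -> differentiable f x.
Proof.
move=> fg dg.
have -> : f = g + (f - g) by apply/funext => y /=; rewrite !fctE addrC subrK.
apply: differentiableD => //; set w : V -> W := f - g.
have w0 : \forall y \near x, w y = 0.
  by apply: filterS fg => y /= fgy; rewrite /w !fctE fgy subrr.
(* A function vanishing near [x] has the first-order expansion with zero linear part, which by
   uniqueness is its differential. *)
have wd : continuous (0 : V -> W) /\ w \o shift x = cst (w x) + \0 +o_ 0 id.
  split; first exact: cst_continuous.
  apply/eqaddoP => e e0.
  move: (w0); rewrite (near_shift 0) subr0 => w0'.
  near=> h; rewrite !fctE /= (nbhs_singleton w0) addr0 subr0.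
  have -> : w (h + x) = 0 by near: h.
  by rewrite normr0 mulr_ge0 // ltW.
have dw : 'd w x = \0 :> (_ -> _) by apply: diff_unique; case: wd.
by apply/diff_locallyP; rewrite dw.
Unshelve. all: by end_near. Qed.

(** * Rules of calculus for partial derivatives *)

Section PartialDerivatives.
Variables (R : realType) (n : nat).
Implicit Types (u v : 'rV[R]_n -> R) (U : set 'rV[R]_n) (x : 'rV[R]_n).

Lemma near_eq_partial i u v x :
  {near x, u =1 v} -> {near x, partial i u =1 partial i v}.
Proof. by move=> /near_join; apply: filterS => y uv; exact: near_eq_derive. Qed.

Lemma near_eq_iter_partial s u v x :
  {near x, u =1 v} -> {near x, iter_partial s u =1 iter_partial s v}.
Proof. by move=> uv; elim: s => //= i s; exact: near_eq_partial. Qed.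

Lemma iter_partial_rcons s i u :
  iter_partial (rcons s i) u = iter_partial s (partial i u).
Proof. by rewrite /iter_partial foldr_rcons. Qed.

Lemma partial_cst i (c : R) x : partial i (fun=> c) x = 0.
Proof. exact: derive_cst. Qed.

Lemma partialD i u v x : differentiable u x -> differentiable v x ->
  partial i (fun y => u y + v y) x = partial i u x + partial i v x.
Proof. by move=> du dv; apply: deriveD; exact: diff_derivable. Qed.

Lemma partialB i u v x : differentiable u x -> differentiable v x ->
  partial i (fun y => u y - v y) x = partial i u x - partial i v x.
Proof. by move=> du dv; apply: deriveB; exact: diff_derivable. Qed.

Lemma partialM i u v x : differentiable u x -> differentiable v x ->
  partial i (fun y => u y * v y) x = u x * partial i v x + v x * partial i u x.
Proof. by move=> du dv; apply: deriveM; exact: diff_derivable. Qed.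

Lemma partialZ i (c : R) u x : differentiable u x ->
  partial i (fun y => c * u y) x = c * partial i u x.
Proof. by move=> du; apply: deriveZ; exact: diff_derivable. Qed.

Lemma partialV i u x : u x != 0 -> differentiable u x ->
  partial i (fun y => (u y)^-1) x = - (u x ^+ 2)^-1 * partial i u x.
Proof. by move=> u0 du; apply: deriveV => //; exact: diff_derivable. Qed.

(** Entry [j] of the derivative of the identity along the basis vector [delta_mx 0 i]. *)
Lemma partial_coord i j x : partial i (fun y => y 0 j) x = (i == j)%:R.
Proof.
have := @derive_mx R _ _ _ id x (delta_mx 0 i) (derivable_id (x:=x) (v:=_)).
rewrite derive_id => /matrixP /(_ 0 j); rewrite !mxE eqxx eq_sym /= => ->.
by [].
Qed.

Lemma differentiable_bigsum (I : Type) (r : seq I) (F : I -> 'rV[R]_n -> R) x :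
  (forall j, differentiable (F j) x) ->
  differentiable (fun y => \sum_(j <- r) F j y) x.
Proof.
move=> dF; elim: r => [|j r IH].
  under eq_fun do rewrite big_nil; exact: differentiable_cst.
under eq_fun do rewrite big_cons; exact: differentiableD.
Qed.

Lemma partial_sum (I : Type) (r : seq I) i (F : I -> 'rV[R]_n -> R) x :
  (forall j, differentiable (F j) x) ->
  partial i (fun y => \sum_(j <- r) F j y) x = \sum_(j <- r) partial i (F j) x.
Proof.
move=> dF; elim: r => [|j r IH].
  by under eq_fun do rewrite big_nil; rewrite big_nil partial_cst.
under eq_fun do rewrite big_cons.
by rewrite big_cons partialD // ?IH //; exact: differentiable_bigsum.
Qed.

End PartialDerivatives.

(** * Closure of smooth functions under algebraic operations *)

Section Smoothness.
Variables (R : realType) (n : nat).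
Implicit Types (u v : 'rV[R]_n -> R) (U : set 'rV[R]_n) (x : 'rV[R]_n).

Lemma smooth_on_partial U u i : smooth_on U u -> smooth_on U (partial i u).
Proof. by move=> su s x Ux; rewrite -iter_partial_rcons; exact: su. Qed.

(** Grading [smooth_on] by order permits induction with the product rule. On an open set this
    condition lies between C^k and C^(k+1), since the partials of order [k] must themselves be
    differentiable. *)
Definition Ck_on k U u := forall s x, (size s <= k)%N -> U x ->
  differentiable (iter_partial s u) x.

(** The derivative peeled off is the innermost one, the last entry of the sequence, so that the
    product rule can act on [u] itself before the other derivatives are taken. *)
Lemma Ck_onS k U u : Ck_on k.+1 U u <->
  (forall x, U x -> differentiable u x) /\ forall i, Ck_on k U (partial i u).
Proof.
split=> [su|[du su] s x].
  split=> [x|i s x ks]; first exact: (su [::]).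
  by rewrite -iter_partial_rcons; apply: su; rewrite size_rcons.
case/lastP: s => [_|s i]; first exact: du.
by rewrite size_rcons iter_partial_rcons; exact: su.
Qed.

Lemma smooth_onP U u : smooth_on U u <-> forall k, Ck_on k U u.
Proof. by split=> su => [k s x _|s x]; [exact: su|exact: (su (size s))]. Qed.

Lemma Ck_on_le k U u : Ck_on k.+1 U u -> Ck_on k U u.
Proof. by move=> su s x sk; apply: su; exact: leqW. Qed.

Lemma eq_Ck_on k U u v : open U -> (forall x, U x -> u x = v x) ->
  Ck_on k U v -> Ck_on k U u.
Proof.
move=> oU uv sv s x sk Ux; apply: near_eq_differentiable (sv s x sk Ux).
apply: near_eq_iter_partial; apply: filterS uv _.
exact: open_nbhs_nbhs.
Qed.

Lemma eq_smooth_on U u v : open U -> (forall x, U x -> u x = v x) ->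
  smooth_on U v -> smooth_on U u.
Proof.
by move=> oU uv /smooth_onP sv; apply/smooth_onP => k; exact: eq_Ck_on (sv k).
Qed.

Variables (U : set 'rV[R]_n) (oU : open U).

Lemma Ck_onD k u v :
  Ck_on k U u -> Ck_on k U v -> Ck_on k U (fun x => u x + v x).
Proof.
elim: k u v => [|k IH] u v.
  move=> du dv [|//] x _ Ux.
  by apply: differentiableD; [exact: (du [::])|exact: (dv [::])].
move=> /Ck_onS[du su] /Ck_onS[dv sv]; apply/Ck_onS; split=> [x Ux|i].
  by apply: differentiableD; [exact: du|exact: dv].
apply: eq_Ck_on (IH _ _ (su i) (sv i)) => // x Ux.
by rewrite partialD //; [exact: du|exact: dv].
Qed.

(** In the product rule each term pairs one factor with a derivative of the other, so both are
    controlled to the lower order [k] and the induction closes. *)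
Lemma Ck_onM k u v :
  Ck_on k U u -> Ck_on k U v -> Ck_on k U (fun x => u x * v x).
Proof.
elim: k u v => [|k IH] u v.
  move=> du dv [|//] x _ Ux.
  by apply: differentiableM; [exact: (du [::])|exact: (dv [::])].
move=> ku kv; move: (ku) (kv) => /Ck_onS[du su] /Ck_onS[dv sv].
apply/Ck_onS; split=> [x Ux|i].
  by apply: differentiableM; [exact: du|exact: dv].
have kuv := Ck_onD (IH _ _ (Ck_on_le ku) (sv i)) (IH _ _ (Ck_on_le kv) (su i)).
by apply: eq_Ck_on kuv => // x Ux; rewrite partialM //; [exact: du|exact: dv].
Qed.

Lemma Ck_on_cst k (c : R) : Ck_on k U (fun=> c).
Proof.
elim: k c => [|k IH] c; first by move=> [|//] x _ _; exact: differentiable_cst.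
apply/Ck_onS; split=> [x _|i]; first exact: differentiable_cst.
by apply: eq_Ck_on (IH 0) => // x _; rewrite partial_cst.
Qed.

(** The derivative of [1 / u] is [- u^-2] times that of [u]: a product in which [1 / u] is needed
    only to the lower order given by induction. *)
Lemma Ck_onV k u : (forall x, U x -> u x != 0) ->
  Ck_on k U u -> Ck_on k U (fun x => (u x)^-1).
Proof.
move=> u0; elim: k => [|k IH].
  by move=> du [|//] x _ Ux; apply: differentiableV; [exact: (du [::])|exact: u0].
move=> ku; move: (ku) => /Ck_onS[du su].
apply/Ck_onS; split=> [x Ux|i].
  by apply: differentiableV; [exact: du|exact: u0].
have kv := IH (Ck_on_le ku).
have kN := Ck_onM (Ck_on_cst (k := k) (-1)) (Ck_onM (Ck_onM kv kv) (su i)).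
apply: eq_Ck_on kN => //.
move=> x Ux; rewrite partialV; [|exact: u0|exact: du].
by rewrite mulrA mulN1r -invfM.
Qed.

Lemma smooth_on_cst (c : R) : smooth_on U (fun=> c).
Proof. by apply/smooth_onP => k; exact: Ck_on_cst. Qed.

Lemma smooth_onD u v :
  smooth_on U u -> smooth_on U v -> smooth_on U (fun x => u x + v x).
Proof.
by move=> /smooth_onP su /smooth_onP sv; apply/smooth_onP => k; exact: Ck_onD.
Qed.

Lemma smooth_onM u v :
  smooth_on U u -> smooth_on U v -> smooth_on U (fun x => u x * v x).
Proof.
by move=> /smooth_onP su /smooth_onP sv; apply/smooth_onP => k; exact: Ck_onM.
Qed.

Lemma smooth_onV u : (forall x, U x -> u x != 0) ->
  smooth_on U u -> smooth_on U (fun x => (u x)^-1).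
Proof. by move=> u0 /smooth_onP su; apply/smooth_onP => k; exact: Ck_onV. Qed.

Lemma smooth_onX u k : smooth_on U u -> smooth_on U (fun x => u x ^+ k).
Proof.
move=> su; elim: k => [|k IH]; first exact: smooth_on_cst.
have -> : (fun x => u x ^+ k.+1) = (fun x => u x * u x ^+ k).
  by apply/funext => x; rewrite exprS.
exact: smooth_onM.
Qed.

Lemma smooth_on_coord i : smooth_on U (fun x => x 0 i).
Proof.
move=> s x Ux; case/lastP: s => [|s j]; first exact: differentiable_coord.
rewrite iter_partial_rcons.
have -> : partial j (fun x : 'rV[R]_n => x 0 i) = fun=> (j == i)%:R.
  by apply/funext => y; rewrite partial_coord.
exact: smooth_on_cst.
Qed.

Lemma smooth_on_sum (I : finType) (F : I -> 'rV[R]_n -> R) :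
  (forall i, smooth_on U (F i)) -> smooth_on U (fun x => \sum_i F i x).
Proof.
move=> sF; elim: (index_enum I) => [|i r IH].
  under eq_fun do rewrite big_nil; exact: smooth_on_cst.
under eq_fun do rewrite big_cons; exact: smooth_onD.
Qed.

End Smoothness.

(** * Mean values along lines and symmetry of mixed partials *)

Section Lines.
Variables (R : realType) (n : nat).
Implicit Types (u : 'rV[R]_n -> R) (x v : 'rV[R]_n).

Lemma is_derive_line u v x (t : R) : derivable u (t *: v + x) v ->
  is_derive t 1 (fun s : R => u (s *: v + x)) ('D_v u (t *: v + x)).
Proof.
have E : (fun h : R => h^-1 *:
      (((fun s => u (s *: v + x)) \o shift t) (h *: 1) - u (t *: v + x))) =
    (fun h => h^-1 *: ((u \o shift (t *: v + x)) (h *: v) - u (t *: v + x))).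
  apply/funext => h /=; congr (_ *: (u _ - _)).
  by rewrite scalerDl addrA [h *: 1]mulr1.
by move=> du; apply: DeriveDef; [rewrite /derivable E|rewrite /derive E].
Qed.

Lemma MVT_line u v x (h : R) : 0 < h ->
  (forall y, differentiable u y) ->
  exists2 t, 0 < t < h & u (h *: v + x) - u x = 'D_v u (t *: v + x) * h.
Proof.
move=> h0 du.
have dl (t : R) : is_derive t 1 (fun s : R => u (s *: v + x)) ('D_v u (t *: v + x)).
  by apply: is_derive_line; exact: diff_derivable.
have [|t] := MVT h0 (fun t _ => dl t).
  apply: derivable_within_continuous => t _; exact: ex_derive.
by rewrite in_itv /= scale0r add0r subr0 => th ->; exists t.
Qed.

(** The derivative in direction [x] is a linear combination of the partials, hence zero; the mean
    value theorem on the segment from [0] to [x] concludes. *)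
Lemma zero_partials_cst u : (forall x, differentiable u x) ->
  (forall i x, partial i u x = 0) -> forall x, u x = u 0.
Proof.
move=> du pu x.
have D0 y : 'D_x u y = 0.
  rewrite deriveE // {1}(row_sum_delta x) linear_sum big1 // => i _.
  by rewrite linearZ /= -deriveE // [X in _ *: X]pu scaler0.
have [t _] := MVT_line x 0 ltr01 du.
by rewrite scale1r addr0 D0 mul0r => /subr0_eq.
Qed.

Lemma derive_translation u v c x : 'D_v (fun y => u (c + y)) x = 'D_v u (c + x).
Proof.
have E : (fun h : R => h^-1 *: (((fun y => u (c + y)) \o shift x) (h *: v)
      - u (c + x))) =
    (fun h => h^-1 *: ((u \o shift (c + x)) (h *: v) - u (c + x))).
  by apply/funext => h /=; rewrite addrCA.
by rewrite /derive E.
Qed.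

(** The mean value theorem is applied twice: in direction [i] to the increment [w] of [u] in
    direction [j], then in direction [j] to [partial i u]. *)
Lemma double_difference u i j x (h : R) : 0 < h -> smooth_on setT u ->
  exists2 y, `|x - y| <=
      h * (`|delta_mx 0 i : 'rV[R]_n| + `|delta_mx 0 j : 'rV[R]_n|) &
    u (h *: delta_mx 0 i + (h *: delta_mx 0 j + x)) - u (h *: delta_mx 0 i + x)
      - (u (h *: delta_mx 0 j + x) - u x) =
    partial j (partial i u) y * h * h.
Proof.
move=> h0 su.
have du s y : differentiable (iter_partial s u) y by exact: su.
pose w y := u (h *: delta_mx 0 j + y) - u y.
have dT y : differentiable (fun y => u (h *: delta_mx 0 j + y)) y.
  apply: (@differentiable_comp _ _ _ _ (fun y => h *: delta_mx 0 j + y) u);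
    last exact: (du [::]).
  apply: differentiableD; [exact: differentiable_cst|exact: ex_diff].
have dw y : differentiable w y.
  by apply: differentiableB; [exact: dT|exact: (du [::])].
have pw y : partial i w y =
    partial i u (h *: delta_mx 0 j + y) - partial i u y.
  rewrite /w partialB; [|exact: dT|exact: (du [::])].
  by rewrite {1}/partial derive_translation.
have [t /andP[t0 th]] := MVT_line (delta_mx 0 i) x h0 dw.
rewrite -/(partial i w _) pw.
have [t' /andP[t'0 t'h]] :=
  MVT_line (delta_mx 0 j) (t *: delta_mx 0 i + x) h0 (du [:: i]).
rewrite -/(partial j _ _) /= => -> E.
exists (t' *: delta_mx 0 j + (t *: delta_mx 0 i + x)).
  rewrite addrA opprD addrCA subrr addr0 normrN addrC mulrDr.
  by rewrite (le_trans (ler_normD _ _)) // lerD // normrZ gtr0_norm // ler_wpM2r // ltW.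
by rewrite -E /w addrCA.
Qed.

(** If the values at [x] differed, [a] and [b] would both stay within half the gap near [x] and
    could share no value there. *)
Lemma continuous_coincide (a b : 'rV[R]_n -> R) x :
  {for x, continuous a} -> {for x, continuous b} ->
  (forall d, 0 < d -> exists y z, [/\ `|x - y| < d, `|x - z| < d & a y = b z]) ->
  a x = b x.
Proof.
move=> ca cb ab; apply/eqP/negPn/negP => neq.
have e0 : 0 < `|a x - b x| / 2 by rewrite divr_gt0 // normr_gt0 subr_eq0.
move/cvgrPdist_lt : ca => /(_ _ e0) ca; move/cvgrPdist_lt : cb => /(_ _ e0) cb.
have [d /= d0 xd] := (nbhs_normP _ _).1 (filterI ca cb).
have [y [z [xy xz abyz]]] := ab d d0.
have [ay _] := xd y xy; have [_ bz] := xd z xz.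
have : `|a x - b x| < `|a x - b x|.
  have {1}-> : a x - b x = (a x - a y) - (b x - b z).
    by rewrite abyz opprB addrA subrK.
  by rewrite [ltRHS]splitr (le_lt_trans (ler_normB _ _)) // ltrD.
by rewrite ltxx.
Qed.

(* Both iterated derivatives are limits of the same second difference quotient. *)
Lemma partialC u i j x : smooth_on setT u ->
  partial i (partial j u) x = partial j (partial i u) x.
Proof.
move=> su; apply: continuous_coincide.
- by apply: differentiable_continuous; exact: (su [:: i; j]).
- by apply: differentiable_continuous; exact: (su [:: j; i]).
move=> d d0; set N := `|delta_mx 0 i : 'rV[R]_n| + `|delta_mx 0 j : 'rV[R]_n|.
have N1 : 0 < N + 1 by rewrite ltr_wpDl // addr_ge0.
(* This makes [h * N < d], so both intermediate points lie within [d] of [x]; adding 1 ensures a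
   positive denominator. *)
pose h := d / 2 / (N + 1).
have h0 : 0 < h by rewrite !divr_gt0.
have hd : h * N < d.
  have : h * (N + 1) = d / 2 by rewrite divfK // gt_eqF.
  rewrite mulrDr mulr1 => E; apply: (@lt_trans _ _ (d / 2)).
    by rewrite -E ltrDl.
  by rewrite ltr_pdivrMr // ltr_pMr // ltr1n.
have [y xy Dy] := double_difference i j x h0 su.
have [z + Dz] := double_difference j i x h0 su; rewrite [_ + `|_|]addrC => xz.
exists z, y; split; [exact: le_lt_trans hd|exact: le_lt_trans hd|].
have h1 : h != 0 by exact: lt0r_neq0.
move: Dy Dz; rewrite [h *: delta_mx 0 j + (_ + _)]addrCA.
move: (u (_ + (_ + _))) (u (h *: delta_mx 0 i + x)) (u (h *: delta_mx 0 j + x)).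
move: (u x) (partial _ _ y) (partial _ _ z) => p b a q r s E1 E2.
apply: (mulIf h1); apply: (mulIf h1); rewrite -E1 -E2.
by rewrite !opprD !opprK !addrA; congr (_ + _); rewrite addrAC.
Qed.
End Lines.

(** * Christoffel symbols and curvature of the rescaled metric *)

Section Curvature.
Variables (R : realType) (n : nat).
Implicit Types (phi : 'rV[R]_n -> R) (x : 'rV[R]_n) (i j k l m : 'I_n).

Local Notation d i j := ((i == j)%:R : R).

Lemma sum_delta (F : 'I_n -> R) k : \sum_l d k l * F l = F k.
Proof.
rewrite (bigD1 k) //= eqxx mul1r big1 ?addr0 // => l /negPf.
by rewrite eq_sym => ->; rewrite mul0r.
Qed.

Lemma deltaC i j : d i j = d j i.
Proof. by rewrite eq_sym. Qed.

Definition dlog phi i x : R := partial i phi x / phi x.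

Lemma partial_dlog phi i j x : differentiable phi x ->
  differentiable (partial j phi) x -> phi x != 0 ->
  partial i (dlog phi j) x =
  partial i (partial j phi) x / phi x - dlog phi i x * dlog phi j x.
Proof.
move=> dp dpj p0; rewrite /dlog partialM //; last exact: differentiableV.
rewrite partialV //.
move: (partial i phi x) (partial j phi x) (partial i _ x) (phi x) p0 => a b c e e0.
by field.
Qed.

Lemma partial_conformal_metric phi i j l x :
  differentiable phi x -> phi x != 0 ->
  partial i (fun y => conformal_metric phi y j l) x =
  - 2 * (phi x ^+ 2)^-1 * d j l * dlog phi i x.
Proof.
move=> dp p0.
have -> : (fun y => conformal_metric phi y j l) =
    (fun y => d j l * (phi y * phi y)^-1).
  by apply/funext => y; rewrite !mxE expr2 mulrC.
have dp2 : differentiable (fun y => phi y * phi y) x by exact: differentiableM.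
have p2 : phi x * phi x != 0 by rewrite mulf_neq0.
rewrite partialZ; last exact: (@differentiableV _ _ _ _ dp2 p2).
rewrite (@partialV _ _ _ (fun y => phi y * phi y)) // partialM // /dlog.
move: (partial i phi x) (phi x) p0 (d j l) => a b b0 e.
by field.
Qed.

(** At a zero of [phi] both sides are 0, by the convention that 0 has inverse 0. *)
Lemma invmx_conformal_metric phi x k l :
  invmx (conformal_metric phi x) k l = phi x ^+ 2 * d k l.
Proof.
by rewrite /conformal_metric /euclidean_metric scalemx1 invmx_scalar invrK mxE mulr_natr.
Qed.

(** This is the usual formula for [e^(2u) g] with [u = - log |phi|], whose partials are
    [- dlog phi i]. *)
Lemma christoffel_conformal phi k i j x : differentiable phi x -> phi x != 0 ->
  christoffel (conformal_metric phi) k i j x =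
  d i j * dlog phi k x - d j k * dlog phi i x - d i k * dlog phi j x.
Proof.
move=> dp p0; rewrite /christoffel.
under eq_bigr do rewrite invmx_conformal_metric mulrAC
  !partial_conformal_metric // mulrAC -mulrA mulrCA.
rewrite sum_delta (deltaC j k) (deltaC i k).
rewrite (deltaC k j) (deltaC k i).
move: (d j k) (d i k) (d i j) (dlog phi i x) (dlog phi j x) (dlog phi k x).
move: (phi x) p0 => a a0 b c e f g h; by field.
Qed.

(** The quadratic term of the curvature, for an arbitrary covector [p]. The terms symmetric in [i]
    and [j] cancel later, when [curvature_endo] antisymmetrizes. *)
Lemma sum_christoffel_conformal (p : 'I_n -> R) i j k l :
  \sum_m (d i m * p k - d m k * p i - d i k * p m)
       * (d j l * p m - d l m * p j - d j m * p l) =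
  d k l * p i * p j + d j k * p i * p l + 2 * d i k * p j * p l
  - d i l * p j * p k - d i j * p k * p l
  - d i k * d j l * \sum_m p m ^+ 2.
Proof.
pose F m := d j l * p m - d l m * p j - d j m * p l.
(* Each term is arranged to carry a delta in [m], which collapses its sum; the one exception is
   [p m ^+ 2], which yields the squared length of [p]. *)
transitivity (\sum_m (d i m * (p k * F m) - d k m * (p i * F m)
   - d i k * (d j l * p m ^+ 2 - d l m * (p m * p j) - d j m * (p m * p l)))).
  apply: eq_bigr => m _; rewrite (deltaC m k) /F.
  by move: (d i m) (d k m) (d i k) (d j l) (d l m) (d j m) => *; ring.
rewrite !sumrB !sum_delta -mulr_sumr !sumrB !sum_delta -mulr_sumr /F.
rewrite (deltaC l i) (deltaC j i) (deltaC l k).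
by move: (\sum__ _) (d i k) (d j l) (d i l) (d i j) (d k l) (d j k) => *; ring.
Qed.

(** The tensor [A] of the overview. As [g] is flat, it is for [n >= 3] the Schouten tensor of the
    rescaled metric. *)
Definition conformal_schouten phi i j x : R :=
  partial i (partial j phi) x / phi x
  - d i j * (\sum_m dlog phi m x ^+ 2) / 2.

(** The right-hand side is [A (.) g] on the basis vectors [i, j, k, l]. The products of two [dlog]
    from the derivatives cancel those of the quadratic term; the remaining squared length is shared
    equally by two entries of [A], whence the factor 1/2. *)
Lemma curvature_endo_conformal phi i j l k x :
  smooth_on setT phi -> phi x != 0 ->
  let A i j := conformal_schouten phi i j x in
  curvature_endo (conformal_metric phi) i j l k x =
  A i k * d j l + A j l * d i k - A i l * d j k - A j k * d i l.
Proof.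
move=> sp p0 A.
have dp y : differentiable phi y by exact: (sp [::]).
have dpp m y : differentiable (partial m phi) y by exact: (sp [:: m]).
have ddl m : differentiable (dlog phi m) x.
  by apply: differentiableM => //; exact: differentiableV.
(* The formula for the Christoffel symbols holds only where [phi] is nonzero; to differentiate it,
   it must hold near [x]. *)
have p0' : \forall y \near x, phi y != 0.
  have /cvgr_neq0 := differentiable_continuous (dp x); exact.
have pG i' j' : partial i' (christoffel (conformal_metric phi) k j' l) x =
    d j' l * (partial i' (partial k phi) x / phi x - dlog phi i' x * dlog phi k x)
    - d l k * (partial i' (partial j' phi) x / phi x - dlog phi i' x * dlog phi j' x)
    - d j' k * (partial i' (partial l phi) x / phi x - dlog phi i' x * dlog phi l x).
  have E : {near x, christoffel (conformal_metric phi) k j' l =1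
     fun y => d j' l * dlog phi k y - d l k * dlog phi j' y - d j' k * dlog phi l y}.
    by apply: filterS p0' => y p0y; exact: christoffel_conformal.
  rewrite (nbhs_singleton (near_eq_partial i' E)).
  have dZ c m : differentiable (fun y => c * dlog phi m y) x.
    exact: (differentiableZ c (ddl m)).
  have dB c m c' m' : differentiable (fun y => c * dlog phi m y - c' * dlog phi m' y) x.
    exact: (differentiableB (dZ c m) (dZ c' m')).
  by rewrite !partialB // !partialZ // !partial_dlog.
have sG i' j' : \sum_m christoffel (conformal_metric phi) k i' m x *
      christoffel (conformal_metric phi) m j' l x =
    _ := eq_trans (eq_bigr _ (fun m _ =>
      congr2 *%R (christoffel_conformal k i' m (dp x) p0)
                 (christoffel_conformal m j' l (dp x) p0)))
    (sum_christoffel_conformal (fun m => dlog phi m x) i' j' k l).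
rewrite /curvature_endo !pG sumrB !sG /A /conformal_schouten.
(* Symmetry of the Hessian removes the second derivatives in [i] and [j], which occur in both orders
   with the factor [d l k]. *)
rewrite (partialC j i) // (deltaC j i) (deltaC l k).
move: (\sum__ _) (d i k) (d j l) (d i l) (d i j) (d k l) (d j k) => *.
move: (dlog phi i x) (dlog phi j x) (dlog phi k x) (dlog phi l x).
move: (partial i (partial j phi) x) (partial i (partial k phi) x).
move: (partial i (partial l phi) x).
move: (partial j (partial k phi) x) (partial j (partial l phi) x).
by move: (phi x) p0 => *; field.
Qed.
End Curvature.

(** * The prescribed curvature equation as an equation for the Schouten tensor *)

Section RiemannTensor.
Variables (R : realType) (n : nat).
Implicit Types (phi : 'rV[R]_n -> R) (x X Y Z W : 'rV[R]_n) (i j k l m : 'I_n).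

Local Notation d i j := ((i == j)%:R : R).

Lemma tensor2_euclidean X Y :
  tensor2 (euclidean_metric R n) X Y = \sum_i X 0 i * Y 0 i.
Proof.
by rewrite /tensor2 mulmx1 mxE; apply: eq_bigr => i _; rewrite mxE.
Qed.

Lemma kulkarni_nomizu_euclidean X Y Z W :
  kulkarni_nomizu (euclidean_metric R n) (euclidean_metric R n) X Y Z W =
  2 * ((\sum_i X 0 i * Z 0 i) * (\sum_i Y 0 i * W 0 i)
       - (\sum_i X 0 i * W 0 i) * (\sum_i Y 0 i * Z 0 i)).
Proof.
rewrite /kulkarni_nomizu !tensor2_euclidean.
by move: (\sum__ _) (\sum__ _) (\sum__ _) (\sum__ _) => *; ring.
Qed.

Lemma riemann_conformal phi x X Y Z W :
  riemann (conformal_metric phi) x X Y Z W =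
  \sum_i \sum_j \sum_k \sum_l
    (phi x ^+ 2)^-1 * curvature_endo (conformal_metric phi) i j l k x
    * X 0 i * Y 0 j * Z 0 k * W 0 l.
Proof.
rewrite /riemann; do 4![apply: eq_bigr => ? _]; do 4!congr (_ * _).
set k := (X in curvature_endo _ _ _ _ X).
rewrite -(sum_delta (fun m => _ * curvature_endo _ _ _ _ m x) k).
apply: eq_bigr => m _; rewrite !mxE.
by rewrite mulrA [_ * d k m]mulrC.
Qed.

Lemma sum4_delta (T : 'I_n -> 'I_n -> 'I_n -> 'I_n -> R) i j k l :
  \sum_i' \sum_j' \sum_k' \sum_l'
    T i' j' k' l' * d i' i * d j' j * d k' k * d l' l = T i j k l.
Proof.
transitivity (\sum_i' d i i' * \sum_j' d j j' * \sum_k' d k k' *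
    \sum_l' d l l' * T i' j' k' l').
  apply: eq_bigr => i' _; rewrite mulr_sumr; apply: eq_bigr => j' _.
  rewrite !mulr_sumr; apply: eq_bigr => k' _; rewrite !mulr_sumr.
  apply: eq_bigr => l' _; rewrite !(eq_sym _ i) !(eq_sym _ j) !(eq_sym _ k) !(eq_sym _ l).
  by move: (d i i') (d j j') (d k k') (d l l') => *; ring.
by rewrite !sum_delta.
Qed.

Lemma riemann_conformal_basis phi x i j k l :
  riemann (conformal_metric phi) x
    (delta_mx 0 i) (delta_mx 0 j) (delta_mx 0 k) (delta_mx 0 l) =
  (phi x ^+ 2)^-1 * curvature_endo (conformal_metric phi) i j l k x.
Proof.
rewrite riemann_conformal -[RHS](sum4_delta (fun i j k l =>
  (phi x ^+ 2)^-1 * curvature_endo (conformal_metric phi) i j l k x)).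
by do 4![apply: eq_bigr => ? _]; rewrite !mxE.
Qed.

Lemma kulkarni_nomizu_basis i j k l :
  kulkarni_nomizu (euclidean_metric R n) (euclidean_metric R n)
    (delta_mx 0 i) (delta_mx 0 j) (delta_mx 0 k) (delta_mx 0 l) =
  2 * (d i k * d j l - d i l * d j k).
Proof.
have E a b : \sum_m (delta_mx 0 a : 'rV[R]_n) 0 m * (delta_mx 0 b : 'rV[R]_n) 0 m = d a b.
  rewrite -[RHS](sum_delta (fun m => d m b)); apply: eq_bigr => m _.
  by rewrite !mxE eqxx /= eq_sym.
by rewrite kulkarni_nomizu_euclidean !E.
Qed.

(** The passage from [A] back to the curvature, by which quadratics are shown to be solutions. *)
Lemma riemann_umbilic phi x (h : R) X Y Z W :
  smooth_on setT phi -> phi x != 0 ->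
  (forall i j, conformal_schouten phi i j x = h * d i j) ->
  riemann (conformal_metric phi) x X Y Z W =
  h / phi x ^+ 2 *
  kulkarni_nomizu (euclidean_metric R n) (euclidean_metric R n) X Y Z W.
Proof.
move=> sp p0 hA; rewrite riemann_conformal kulkarni_nomizu_euclidean.
set c := (phi x ^+ 2)^-1.
rewrite !big_distrlr /= -sumrB !mulr_sumr; apply: eq_bigr => i _.
rewrite -sumrB !mulr_sumr; apply: eq_bigr => j _.
transitivity (2 * c * h * X 0 i * Y 0 j *
  (\sum_k d i k * (Z 0 k * \sum_l d j l * W 0 l)
   - \sum_k d j k * (Z 0 k * \sum_l d i l * W 0 l))).
  rewrite -sumrB mulr_sumr; apply: eq_bigr => k _.
  rewrite !mulr_sumr -sumrB mulr_sumr; apply: eq_bigr => l _.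
  rewrite curvature_endo_conformal // !hA.
  by move: (d i k) (d j l) (d i l) (d j k) => *; ring.
by rewrite !sum_delta; ring.
Qed.

Hypothesis n_ge3 : (3 <= n)%N.

(** The geometric use of [n >= 3]: the complement of at most two indices is nonempty. *)
Lemma exists_third i j : exists k, k != i /\ k != j.
Proof.
have : (0 < #|predC (pred2 i j)|)%N.
  have := cardC (pred2 i j); rewrite card2 card_ord => E.
  by rewrite -(ltn_add2l (i != j).+1) E addn0 (leq_trans _ n_ge3) // !ltnS leq_b1.
by move=> /card_gt0P[k]; rewrite !inE negb_or => /andP[]; exists k.
Qed.

(** The components [a, b, a, b] of the curvature give the sums [A a a + A b b] for [a != b], and the
    components [k, i, k, j] with distinct indices isolate [A i j]. *)
Lemma schouten_of_prescribed_curvature f phi x i j :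
  smooth_on setT phi -> has_prescribed_curvature f phi -> phi x != 0 ->
  conformal_schouten phi i j x = f x * phi x ^+ 2 * d i j.
Proof.
move=> sp hf p0; set A := fun i j => conformal_schouten phi i j x.
have c0 : phi x ^+ 2 != 0 by rewrite expf_neq0.
have E i' j' l k : A i' k * d j' l + A j' l * d i' k - A i' l * d j' k - A j' k * d i' l
    = phi x ^+ 2 * f x * (2 * (d i' k * d j' l - d i' l * d j' k)).
  have sx : ~ singularities phi x by exact/eqP.
  move: (hf x sx) => /(_ (delta_mx 0 i') (delta_mx 0 j') (delta_mx 0 k) (delta_mx 0 l)).
  rewrite riemann_conformal_basis kulkarni_nomizu_basis curvature_endo_conformal //.
  by move=> E; rewrite -mulrA -E mulVKf.
have A2 a b : a != b -> A a a + A b b = phi x ^+ 2 * f x * 2.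
  move=> ab; have := E a b b a.
  by rewrite !eqxx (negPf ab) [b == a]eq_sym (negPf ab) !mulr0 !subr0 !mulr1.
have [<-|ij] := eqVneq i j.
  (* Three distinct indices give three equations for pairwise sums, which determine each diagonal
     entry. *)
  have [k [ki _]] := exists_third i i; have [m [mi mk]] := exists_third i k.
  have := A2 _ _ ki; have := A2 _ _ mi; have := A2 _ _ mk.
  rewrite -/(A i i) mulr1; move: (A i i) (A k k) (A m m) (f x) (phi x ^+ 2).
  by move=> a b c e g; lra.
have [k [ki kj]] := exists_third i j.
have := E k i j k.
rewrite eqxx (negPf ij) (negPf kj) [i == k]eq_sym (negPf ki).
by rewrite !mulr0 !subr0 !mulr0 mulr1 add0r /A => ->.
Qed.

End RiemannTensor.

Lemma near_neq0 (R : realType) (n : nat) (u : 'rV[R]_n -> R) x :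
  differentiable u x -> u x != 0 -> \forall y \near x, u y != 0.
Proof. by move=> /differentiable_continuous /cvgr_neq0; exact. Qed.

Lemma open_nonsingular (R : realType) (n : nat) (phi : 'rV[R]_n -> R) :
  (forall x, differentiable phi x) -> open (~` singularities phi).
Proof.
move=> dphi; rewrite openE => x /eqP phi0.
by apply: filterS (near_neq0 (dphi x) phi0) => y /eqP.
Qed.

(** * Quadratic polynomials as solutions *)

Section Quadratic.
Variables (R : realType) (n : nat).
Implicit Types (a c : R) (b x y : 'rV[R]_n) (i j k : 'I_n).

Local Notation d i j := ((i == j)%:R : R).

Lemma smooth_on_quadratic a b c U : open U -> smooth_on U (quadratic a b c).
Proof.
move=> oU; apply: smooth_onD => //; last exact: smooth_on_cst.
apply: smooth_on_sum => // i; apply: smooth_onD => //; apply: smooth_onM => //.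
- exact: smooth_on_cst.
- by apply: smooth_onX => //; exact: smooth_on_coord.
- exact: smooth_on_cst.
- exact: smooth_on_coord.
Qed.

Lemma partial_quadratic a b c i :
  partial i (quadratic a b c) = (fun x => 2 * a * x 0 i + b 0 i).
Proof.
apply/funext => x.
have dc j y : differentiable (fun x : 'rV[R]_n => x 0 j) y.
  exact: differentiable_coord.
have dM j e : differentiable (fun x : 'rV[R]_n => e * x 0 j) x.
  exact: (differentiableZ e (dc j x)).
have dM2 j : differentiable (fun x : 'rV[R]_n => a * (x 0 j * x 0 j)) x.
  exact: (differentiableZ a (differentiableM (dc j x) (dc j x))).
have dT j : differentiable (fun x : 'rV[R]_n => a * (x 0 j * x 0 j) + b 0 j * x 0 j) x.
  exact: (differentiableD (dM2 j) (dM j _)).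
have -> : quadratic a b c = fun x => \sum_j (a * (x 0 j * x 0 j) + b 0 j * x 0 j) + c.
  by apply/funext => y; rewrite /quadratic; under eq_bigr do rewrite expr2.
rewrite partialD; [|exact: differentiable_bigsum|exact: differentiable_cst].
rewrite partial_cst addr0 partial_sum //.
rewrite -[RHS](sum_delta (fun j => 2 * a * x 0 j + b 0 j)); apply: eq_bigr => j _.
rewrite partialD // !partialZ //; last exact: differentiableM.
rewrite partialM // partial_coord.
by move: (d i j) => *; ring.
Qed.

Lemma hessian_quadratic a b c i j x :
  partial i (partial j (quadratic a b c)) x = 2 * a * d i j.
Proof.
have dc : differentiable (fun x : 'rV[R]_n => x 0 j) x.
  exact: differentiable_coord.
rewrite partial_quadratic partialD;
  [|exact: (differentiableZ (2 * a) dc)|exact: differentiable_cst].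
by rewrite partialZ // partial_coord partial_cst addr0.
Qed.

(** Expanding the squares gives [4 * a] times the quadratic without its constant term, plus the
    squared length of [b]; [lambda] accounts for the missing [4 * a * c]. *)
Lemma gradient_quadratic a b c x :
  \sum_i (2 * a * x 0 i + b 0 i) ^+ 2 = lambda a b c + 4 * a * quadratic a b c x.
Proof.
rewrite /lambda /quadratic mulrDr addrACA addrA subrK mulr_sumr -big_split /=.
by apply: eq_bigr => i _; ring.
Qed.

(** The Hessian term [2 * a / q] cancels against the summand [4 * a * q] of the squared gradient,
    leaving only [lambda]. *)
Lemma schouten_quadratic a b c i j x : quadratic a b c x != 0 ->
  conformal_schouten (quadratic a b c) i j x =
  - lambda a b c / (2 * quadratic a b c x ^+ 2) * d i j.
Proof.
move=> q0; rewrite /conformal_schouten hessian_quadratic.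
have -> : \sum_m dlog (quadratic a b c) m x ^+ 2 =
   (lambda a b c + 4 * a * quadratic a b c x) / quadratic a b c x ^+ 2.
  by rewrite -gradient_quadratic mulr_suml; apply: eq_bigr => m _;
    rewrite /dlog partial_quadratic expr_div_n.
by move: (quadratic _ _ _ _) q0 (d i j) => *; field.
Qed.

Lemma curvature_quadratic a b c :
  has_prescribed_curvature (curvature_factor a b c) (quadratic a b c).
Proof.
move=> x /eqP q0 X Y Z W.
rewrite (riemann_umbilic _ _ _ _ _ q0 (fun i j => schouten_quadratic i j q0)).
  congr (_ * _); rewrite /curvature_factor.
  by move: (quadratic _ _ _ _) q0 => *; field.
by apply: smooth_on_quadratic; exact: openT.
Qed.

Lemma quadratic_is_solution f a b c : lambda a b c != 0 ->
  (forall x, ~ singularities (quadratic a b c) x -> f x = curvature_factor a b c x) ->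
  is_solution f (quadratic a b c).
Proof.
move=> l0 fE.
have oU : open (~` singularities (quadratic a b c)).
  apply: open_nonsingular => x.
  by apply: (smooth_on_quadratic _ _ _ openT [::]).
split.
- by apply: smooth_on_quadratic; exact: openT.
(* An identically zero quadratic has [c = 0], its value at 0, and [b = 0], its gradient at 0, so
   [lambda] would vanish. *)
- apply: contrapT => /forallNP all0.
  have q0 x : quadratic a b c x = 0 by exact: contrapT (all0 x).
  have c0 : c = 0.
    have := q0 0; rewrite /quadratic big1 ?add0r // => i _.
    by rewrite mxE expr0n mulr0 mulr0 addr0.
  have b0 i : b 0 i = 0.
    have := congr1 (fun u => partial i u 0) (funext q0).
    by rewrite partial_quadratic partial_cst mxE mulr0 add0r.
  move/eqP: l0; apply; rewrite /lambda c0 mulr0 subr0 big1 // => i _.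
  by rewrite b0 expr0n.
- apply: (eq_smooth_on oU fE).
  apply: smooth_onM => //; first exact: smooth_on_cst.
  apply: smooth_onV => //.
    by move=> x /eqP q0; rewrite mulf_neq0 ?pnatr_eq0 ?expf_neq0.
  apply: smooth_onM => //; first exact: smooth_on_cst.
  by apply: smooth_onX => //; exact: smooth_on_quadratic.
- move=> x sx; rewrite fE // /curvature_factor mulf_neq0 ?oppr_eq0 //.
  by move/eqP: sx => q0; rewrite invr_eq0 mulf_neq0 ?pnatr_eq0 ?expf_neq0.
- by move=> x sx X Y Z W; rewrite fE //; exact: curvature_quadratic.
Qed.

End Quadratic.

(** * Every solution is a quadratic polynomial *)

Section Rigidity.
Variables (R : realType) (n : nat) (n_ge3 : (3 <= n)%N).
Variables (f phi : 'rV[R]_n -> R).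
Hypotheses (phi_smooth : smooth_on setT phi) (f_phi : has_prescribed_curvature f phi).
Implicit Types (x : 'rV[R]_n) (i j k : 'I_n).

Local Notation d i j := ((i == j)%:R : R).

Let dphi s x : differentiable (iter_partial s phi) x.
Proof. exact: phi_smooth. Qed.

(** Solving [A = f phi^2 g] for the Hessian; at this stage the factor [h] may still vary with the
    point. *)
Lemma hessian_of_prescribed_curvature x : phi x != 0 ->
  exists h, forall i j, partial i (partial j phi) x = h * d i j.
Proof.
move=> p0.
exists (phi x * (f x * phi x ^+ 2 + (\sum_m dlog phi m x ^+ 2) / 2)) => i j.
have := schouten_of_prescribed_curvature n_ge3 i j phi_smooth f_phi p0.
rewrite /conformal_schouten => /eqP; rewrite subr_eq => /eqP E.
rewrite -[LHS](divfK p0) E.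
by move: (\sum__ _) (d i j) => *; ring.
Qed.

(** Off-diagonal Hessian entries vanish near [x], so their derivatives do. Exchanging partials
    reduces a derivative of a diagonal entry in another direction to that case. For [i, i, i],
    equality of the diagonal entries replaces the inner pair by [j, j] with [j != i]. *)
Lemma third_partial_off_singularities x i j k : phi x != 0 ->
  partial k (partial i (partial j phi)) x = 0.
Proof.
have offdiag y a b e : phi y != 0 -> a != b -> partial e (partial a (partial b phi)) y = 0.
  move=> p0 ab; rewrite -(partial_cst e 0 y).
  apply: near_eq_derive; apply: filterS (near_neq0 (dphi [::] _) p0) => z.
  by move=> /hessian_of_prescribed_curvature[h ->]; rewrite (negPf ab) mulr0.
have diag y a e : phi y != 0 -> e != a -> partial e (partial a (partial a phi)) y = 0.
  move=> p0 ea; rewrite partialC; last exact: smooth_on_partial.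
  exact: offdiag.
move=> p0; have [<-{j}|ij] := eqVneq i j; last exact: offdiag.
have [->|] := eqVneq k i; last exact: diag.
have [j [ji _]] := exists_third n_ge3 i i.
rewrite -(diag x j i p0); last by rewrite eq_sym.
apply: near_eq_derive; apply: filterS (near_neq0 (dphi [::] _) p0) => z.
by move=> /hessian_of_prescribed_curvature[h H]; rewrite !H !eqxx.
Qed.

(* A point where this continuous function is nonzero would have a
   neighbourhood of singularities, on which phi vanishes identically. *)
Lemma third_partial_eq0 x i j k : partial k (partial i (partial j phi)) x = 0.
Proof.
apply/eqP/negPn/negP => t0.
have ct := differentiable_continuous (dphi [:: k; i; j] x).
have phi0 : {near x, phi =1 fun=> 0}.
  move/cvgr_neq0 : ct => /(_ t0); apply: filterS => y; apply: contraNeq => p0.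
  by apply/eqP; exact: third_partial_off_singularities.
move/eqP: t0; apply.
have /nbhs_singleton /= -> := near_eq_iter_partial [:: k; i; j] phi0.
have -> : partial j (fun=> 0 : R) = (fun=> 0 : R) :> ('rV[R]_n -> R).
  by apply/funext => y; rewrite partial_cst.
have -> : partial i (fun=> 0 : R) = (fun=> 0 : R) :> ('rV[R]_n -> R).
  by apply/funext => y; rewrite partial_cst.
exact: partial_cst.
Qed.

(** Three integrations: constant Hessian, affine gradient, quadratic function. Each subtracts the
    expected expression and applies [zero_partials_cst]. *)
Lemma prescribed_curvature_quadratic : (exists x, phi x != 0) ->
  exists a b c, forall x, phi x = quadratic a b c x.
Proof.
move=> [x0 /hessian_of_prescribed_curvature [h H0]].
(* The Hessian of the quadratic is [2 * a] times the identity; its value at [x0] determines it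
   everywhere. *)
pose a := h / 2.
have H i j x : partial i (partial j phi) x = 2 * a * d i j.
  have cst y := zero_partials_cst (dphi [:: i; j]) (fun k z => third_partial_eq0 z i j k) y.
  have /= -> := cst x; have /= <- := cst x0.
  by rewrite H0 /a [2 * _]mulrC divfK ?pnatr_eq0.
have G i x : partial i phi x - 2 * a * x 0 i = partial i phi 0.
  have dc y : differentiable (fun x : 'rV[R]_n => 2 * a * x 0 i) y.
    exact: (differentiableZ (2 * a) (differentiable_coord _ _ _)).
  rewrite (@zero_partials_cst _ _ (fun x => partial i phi x - 2 * a * x 0 i)) //.
  - by rewrite mxE mulr0 subr0.
  - move=> y; apply: differentiableB => //; exact: (dphi [:: i]).
  - move=> k y; rewrite partialB //; last exact: (dphi [:: i]).
    rewrite H partialZ; last exact: differentiable_coord.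
    by rewrite partial_coord subrr.
pose b : 'rV[R]_n := \row_i partial i phi 0.
exists a, b, (phi 0) => x.
have dq y : differentiable (quadratic a b 0) y.
  by apply: (smooth_on_quadratic _ _ _ openT [::]).
have := @zero_partials_cst _ _ (fun x => phi x - quadratic a b 0 x).
move=> /(_ _ _ x) E.
have {E} : phi x - quadratic a b 0 x = phi 0 - quadratic a b 0 0.
  apply: E => [y|i y]; first by apply: differentiableB => //; exact: (dphi [::]).
  rewrite partialB //; last exact: (dphi [::]).
  by rewrite partial_quadratic mxE -(G i y) [2 * a * _ + _]addrC subrK subrr.
rewrite {2}/quadratic big1 => [|i _]; last by rewrite !mxE expr0n !mulr0 addr0.
rewrite addr0 subr0 => /eqP; rewrite subr_eq => /eqP ->.
by rewrite /quadratic addr0 addrC.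
Qed.

End Rigidity.

(** * Classification of solutions and uniqueness up to homothety *)

Section Solutions.
Variables (R : realType) (n : nat).
Implicit Types (a c : R) (b x y : 'rV[R]_n) (f phi psi : 'rV[R]_n -> R).

(** Once [phi] is quadratic, comparing two expressions for a diagonal entry of [A] gives [f]. Its
    nonvanishing at a single nonsingular point forces [lambda != 0]. *)
Lemma is_solutionP f phi : (3 <= n)%N ->
  is_solution f phi <->
  (exists a b c, [/\ lambda a b c != 0,
      (forall x, phi x = quadratic a b c x) &
      (forall x, ~ singularities phi x -> f x = curvature_factor a b c x)]).
Proof.
move=> n3; split=> [[sp [x0 sx0] sf f0 hf]|[a [b [c [l0 /funext -> fE]]]]]; last first.
  exact: quadratic_is_solution.
have [|a [b [c qE]]] := prescribed_curvature_quadratic n3 sp hf.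
  by exists x0; exact/eqP.
have fE x : ~ singularities phi x -> f x = curvature_factor a b c x.
  move=> sx; move/eqP: (sx) => p0.
  have i : 'I_n by exact: Ordinal (ltn_trans (ltn0Sn 1) n3).
  have := schouten_of_prescribed_curvature n3 i i sp hf p0.
  rewrite (funext qE) in p0 *; rewrite schouten_quadratic // eqxx !mulr1.
  rewrite /curvature_factor => E; apply: (mulIf (expf_neq0 2 p0)); rewrite -E.
  by move: (quadratic _ _ _ _) p0 => *; field.
exists a, b, c; split=> //.
have := f0 x0 sx0; rewrite fE //; apply: contra_neq => l0.
by rewrite /curvature_factor l0 oppr0 mul0r.
Qed.

(** At [x] both the quadratic and its gradient vanish, so [gradient_quadratic] reduces to
    [lambda = 0]. *)
Lemma near_eq0_quadratic a b c x :
  {near x, quadratic a b c =1 fun=> 0} -> lambda a b c = 0.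
Proof.
move=> q0; have := gradient_quadratic a b c x.
rewrite (nbhs_singleton q0) mulr0 addr0 => <-; apply: big1 => i _.
rewrite -[_ + b 0 i]/((fun y => 2 * a * y 0 i + b 0 i) x) -(partial_quadratic _ _ c).
by rewrite (nbhs_singleton (near_eq_partial i q0)) partial_cst expr0n.
Qed.

Section Proportionality.
Variables (f : 'rV[R]_n -> R).
Variables (a1 a2 : R) (b1 b2 : 'rV[R]_n) (c1 c2 : R).
Let q1 := quadratic a1 b1 c1.
Let q2 := quadratic a2 b2 c2.
Let l1 := lambda a1 b1 c1.
Let l2 := lambda a2 b2 c2.
Hypothesis l2_neq0 : l2 != 0.
Hypotheses (fE1 : forall x, ~ singularities q1 x -> f x = curvature_factor a1 b1 c1 x)
  (fE2 : forall x, ~ singularities q2 x -> f x = curvature_factor a2 b2 c2 x).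

Lemma proportional_off_singularities x : q1 x != 0 -> q2 x != 0 ->
  l1 * q2 x ^+ 4 = l2 * q1 x ^+ 4.
Proof.
move=> x1 x2; have s1 : ~ singularities q1 x by exact/eqP.
have s2 : ~ singularities q2 x by exact/eqP.
have := fE1 s1; rewrite (fE2 s2) /curvature_factor -/(q1 x) -/(q2 x) -/l1 -/l2.
move: (q1 x) (q2 x) x1 x2 (l1) (l2) => u v u0 v0 k m E.
have -> : k * v ^+ 4 = (- k / (2 * u ^+ 4)) * (- 2 * u ^+ 4 * v ^+ 4) by field.
by rewrite -E; field.
Qed.

(* Near a zero of q2 where q1 does not vanish the proportionality would force
   q2 to vanish identically. *)
Lemma singularities_subset x : q2 x = 0 -> q1 x = 0.
Proof.
move=> x2; apply/eqP/negPn/negP => x1; move/eqP: l2_neq0; apply.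
have d1 y : differentiable q1 y by exact: (smooth_on_quadratic _ _ _ openT [::]).
have sT l a b c : smooth_on setT (fun y => l * quadratic a b c y ^+ 4).
  apply: smooth_onM; [exact: openT|exact: (smooth_on_cst openT)|].
  by apply: smooth_onX; [exact: openT|exact/smooth_on_quadratic/openT].
have sP : smooth_on setT (fun y => l1 * q2 y ^+ 4 + (- l2) * q1 y ^+ 4).
  by apply: smooth_onD; [exact: openT|exact: sT|exact: sT].
apply: (@near_eq0_quadratic a2 b2 c2 x); near=> y.
apply/eqP/negPn/negP => y2.
have y1 : q1 y != 0 by near: y; exact: near_neq0.
have : l1 * q2 y ^+ 4 + (- l2) * q1 y ^+ 4 != 0.
  near: y; apply: near_neq0; first exact: (sP [::]).
  by rewrite x2 expr0n mulr0 add0r mulf_neq0 ?oppr_eq0 ?expf_neq0.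
by rewrite proportional_off_singularities // mulNr subrr eqxx.
Unshelve. all: by end_near. Qed.

End Proportionality.

Lemma solutions_homothetic f phi psi : (3 <= n)%N ->
  is_solution f phi -> is_solution f psi -> homothetic phi psi.
Proof.
move=> n3 s1 s2; have [x0 /eqP p0] := sol_nonempty s1; move: s1 s2 p0.
move=> /is_solutionP-/(_ n3) [a1 [b1 [c1 [l1 /funext -> fE1]]]].
move=> /is_solutionP-/(_ n3) [a2 [b2 [c2 [l2 /funext -> fE2]]]] p0.
(* The two inclusions are the same lemma with the quadratics exchanged, as both have nonzero
   [lambda]. *)
have s12 x : (quadratic a1 b1 c1 x == 0) = (quadratic a2 b2 c2 x == 0).
  apply/eqP/eqP; first exact: (singularities_subset l1 fE2 fE1).
  exact: (singularities_subset l2 fE1 fE2).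
have q0 : quadratic a2 b2 c2 x0 != 0 by rewrite -s12.
have prop := proportional_off_singularities fE1 fE2.
split.
  by apply/seteqP; split=> x /= /eqP sx; apply/eqP; [rewrite -s12|rewrite s12].
(* The ratio of the two metrics at [x0] is the only possible factor. *)
exists (quadratic a2 b2 c2 x0 ^+ 2 / quadratic a1 b1 c1 x0 ^+ 2).
  by rewrite divr_gt0 // exprn_even_gt0.
move=> x /eqP p; have q : quadratic a2 b2 c2 x != 0 by rewrite -s12.
rewrite /conformal_metric scalerA; congr (_ *: _).
have E0 := prop x0 p0 q0; have E := prop x p q.
move: (quadratic a1 _ _ x0) (quadratic a2 _ _ x0) (quadratic a1 _ _ x)
  (quadratic a2 _ _ x) p0 q0 p q E0 E => u0 v0 u v hu0 hv0 hu hv E0 E.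
(* Combining the proportionalities at [x0] and [x] eliminates the first [lambda], and the second
   cancels. The squared quantities are nonnegative, so square roots can be taken. *)
have : (u0 ^+ 2 * v ^+ 2) ^+ 2 = (v0 ^+ 2 * u ^+ 2) ^+ 2.
  apply: (mulfI l2).
  have -> : lambda a2 b2 c2 * (u0 ^+ 2 * v ^+ 2) ^+ 2 =
      lambda a2 b2 c2 * u0 ^+ 4 * v ^+ 4 by move: (lambda _ _ _) => *; ring.
  rewrite -E0 mulrAC E; move: (lambda _ _ _) => *; ring.
move=> /eqP; rewrite (eqrXn2 (isT : (0 < 2)%N) (mulr_ge0 (sqr_ge0 _) (sqr_ge0 _))
  (mulr_ge0 (sqr_ge0 _) (sqr_ge0 _))) => /eqP S.
have -> : v0 ^+ 2 = u0 ^+ 2 * v ^+ 2 / u ^+ 2 by rewrite S mulfK // expf_neq0.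
by field; rewrite hu0 hu hv.
Qed.

(** * Shape of the singular set *)

Lemma quadratic0E b c x : quadratic 0 b c x = \sum_i b 0 i * x 0 i + c.
Proof.
by rewrite /quadratic; congr (_ + _); apply: eq_bigr => i _; rewrite mul0r add0r.
Qed.

(** At a zero of the quadratic, [gradient_quadratic] makes [lambda] a sum of squares. *)
Lemma singularities_lambda_lt0 a b c :
  lambda a b c < 0 -> singularities (quadratic a b c) = set0.
Proof.
move=> l0; apply/seteqP; split=> // x sx.
have := gradient_quadratic a b c x; rewrite [quadratic _ _ _ _]sx mulr0 addr0 => E.
by move: l0; rewrite -E ltNge sumr_ge0 // => i _; exact: sqr_ge0.
Qed.

(** With [a = 0], [lambda] is the squared length of [b], so [b = 0] and the quadratic is the
    constant [c], nonzero because some point is nonsingular. *)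
Lemma singularities_cst b c : lambda 0 b c = 0 ->
  (exists x, ~ singularities (quadratic 0 b c) x) ->
  singularities (quadratic 0 b c) = set0.
Proof.
rewrite /lambda mulr0 mul0r subr0 => l0 [y sy].
have b0 i : b 0 i = 0.
  have /(_ i isT)/eqP := psumr_eq0P (fun i _ => sqr_ge0 (b 0 i)) l0.
  by rewrite sqrf_eq0 => /eqP.
have qc x : quadratic 0 b c x = c.
  by rewrite quadratic0E big1 ?add0r // => i _; rewrite b0 mul0r.
apply/seteqP; split=> // x; rewrite /singularities /= qc => c0.
by case: sy; rewrite /singularities /= qc.
Qed.

(** Completing the square, by dividing [gradient_quadratic] by [4 * a ^+ 2]. The zero set has centre
    [- b / (2 a)], and the sign of [lambda] decides between a point and a sphere. *)
Lemma quadratic_eq0 a b c x : a != 0 ->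
  quadratic a b c x = 0 <->
  \sum_i (x 0 i - (- (2 * a)^-1 *: b) 0 i) ^+ 2 = lambda a b c / (4 * a ^+ 2).
Proof.
move=> a0.
have -> : \sum_i (x 0 i - (- (2 * a)^-1 *: b) 0 i) ^+ 2 =
    (lambda a b c + 4 * a * quadratic a b c x) / (4 * a ^+ 2).
  rewrite -gradient_quadratic mulr_suml; apply: eq_bigr => i _; rewrite mxE.
  by move: (x 0 i) (b 0 i) => *; field.
rewrite mulrDl; split=> [->|/eqP]; first by rewrite mulr0 mul0r addr0.
rewrite -subr_eq0 addrAC subrr add0r !mulf_eq0 invr_eq0 mulf_eq0 sqrf_eq0.
rewrite !pnatr_eq0 (negPf a0) /= orbF.
by move/eqP.
Qed.

Lemma singularities_point a b c : lambda a b c = 0 -> a != 0 ->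
  singularities (quadratic a b c) = [set - (2 * a)^-1 *: b].
Proof.
move=> l0 a0; apply/seteqP; split=> x.
  move=> /(quadratic_eq0 _ _ _ a0); rewrite l0 mul0r => /psumr_eq0P E.
  apply/rowP => i; apply/eqP; rewrite -subr_eq0 -sqrf_eq0; apply/eqP.
  by apply: E => // j _; exact: sqr_ge0.
move=> /= ->; apply/(quadratic_eq0 _ _ _ a0).
by rewrite l0 mul0r big1 // => i _; rewrite subrr expr0n.
Qed.

(** The normal vector is [b], nonzero since [lambda] is its squared length when [a = 0]. *)
Lemma singularities_hyperplane b c : 0 < lambda 0 b c ->
  is_hyperplane (singularities (quadratic 0 b c)).
Proof.
move=> l0; exists b, (- c); split.
  apply/eqP => b0; move: l0; rewrite /lambda mulr0 mul0r subr0 big1 ?ltxx // => i _.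
  by rewrite b0 mxE expr0n.
apply/seteqP; split=> x; rewrite /singularities /= quadratic0E.
  by move=> /eqP; rewrite addr_eq0 => /eqP.
by move=> ->; rewrite addNr.
Qed.

Lemma singularities_sphere a b c : 0 < lambda a b c -> a != 0 ->
  is_sphere (singularities (quadratic a b c)).
Proof.
move=> l0 a0; exists (- (2 * a)^-1 *: b), (Num.sqrt (lambda a b c / (4 * a ^+ 2))).
have r0 : 0 < lambda a b c / (4 * a ^+ 2).
  by rewrite divr_gt0 // mulr_gt0 // exprn_even_gt0.
split; first by rewrite sqrtr_gt0.
by rewrite sqr_sqrtr ?ltW //; apply/seteqP; split=> x /(quadratic_eq0 _ _ _ a0).
Qed.

End Solutions.

Theorem theorem3p3 (R : realType) (n : nat) (n_ge3 : (3 <= n)%N) :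
  [/\ (forall f : 'rV[R]_n -> R,
         (exists phi : 'rV[R]_n -> R, is_solution f phi) <->
         (exists (a : R) (b : 'rV[R]_n) (c : R),
            lambda a b c != 0 /\
            forall x, ~ singularities (quadratic a b c) x ->
              f x = curvature_factor a b c x)),
      (forall f phi : 'rV[R]_n -> R,
         is_solution f phi <->
         (exists (a : R) (b : 'rV[R]_n) (c : R),
            [/\ lambda a b c != 0,
                (forall x, phi x = quadratic a b c x) &
                (forall x, ~ singularities phi x ->
                   f x = curvature_factor a b c x)])),
      (forall f phi psi : 'rV[R]_n -> R,
         is_solution f phi -> is_solution f psi -> homothetic phi psi) &
      (forall (a : R) (b : 'rV[R]_n) (c : R),
         let phi := quadratic a b c in
         let lam := lambda a b c in
         (exists x, ~ singularities phi x) ->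
         [/\ has_prescribed_curvature (curvature_factor a b c) phi,
             (lam < 0 -> singularities phi = set0),
             (lam = 0 -> a = 0 -> singularities phi = set0),
             (lam = 0 -> a <> 0 -> exists p, singularities phi = [set p]) &
             ((lam > 0 -> a = 0 -> is_hyperplane (singularities phi)) /\
              (lam > 0 -> a <> 0 -> is_sphere (singularities phi)))])].
Proof.
split.
- move=> f; split=> [[phi /is_solutionP-/(_ n_ge3)]|[a [b [c [l0 fE]]]]].
    by move=> [a [b [c [l0 /funext -> fE]]]]; exists a, b, c.
  by exists (quadratic a b c); exact: quadratic_is_solution.
- by move=> f phi; exact: is_solutionP.
- by move=> f phi psi; exact: solutions_homothetic.
- move=> a b c phi lam ne; split.
  + exact: curvature_quadratic.
  + exact: singularities_lambda_lt0.
  + move=> l0 a0; move: ne l0; rewrite /phi /lam a0 => ne l0.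
    exact: singularities_cst.
  + by move=> l0 /eqP a0; eexists; exact: singularities_point.
  + split=> [l0 a0|l0 /eqP a0]; last exact: singularities_sphere.
    by move: l0; rewrite /lam /phi a0; exact: singularities_hyperplane.
Qed.
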